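(* Let $\{p_n\}_{n\ge 0}$ and $\{q_n\}_{n\ge 0}$ be sequences of positive real numbers and let $k>1$. Let $k^{*}$ be the conjugate index of $k$, i.e. $1/k+1/k^{*}=1$. Then $|\overline{N},p_n|_k\Rightarrow|\overline{N},q_n|_k$ (every series summable $|\overline{N},p_n|_k$ is summable $|\overline{N},q_n|_k$) if and only if both of the following hold: (i) $$\frac{q_nP_n}{p_nQ_n}=O(1)\qquad(n\ge 1),$$ and (ii) $$\left(\sum_{n=m+1}^{\infty}\left(n^{1-1/k}\frac{q_n}{Q_nQ_{n-1}}\right)^{k}\right)^{1/k}\left(\sum_{v=1}^{m}\left|Q_v-\frac{q_vP_v}{p_v}\right|^{k^{*}}\frac1v\right)^{1/k^{*}}=O(1)\qquad(m\ge 1).$$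
   Context: For positive sequences $\{p_n\}_{n\ge0}$, $\{q_n\}_{n\ge 0}$ put $P_n=\sum_{i=0}^n p_i$ and $Q_n=\sum_{i=0}^n q_i$. Given a series $\sum_{n\ge 0} a_n$ with partial sums $s_n=\sum_{i=0}^n a_i$, the $n$th term of its $(\overline{N},p_n)$ (weighted mean) transform is $T_n=\frac1{P_n}\sum_{i=0}^n p_i s_i$. For $k>1$, the series $\sum a_n$ is called summable $|\overline{N},p_n|_k$ if $\sum_{n=1}^\infty n^{k-1}|\Delta T_n|^k<\infty$, where $\Delta T_n=T_n-T_{n-1}$. Summability $|\overline{N},q_n|_k$ is defined in the same way with $q_n$, $Q_n$ in place of $p_n$, $P_n$. The notation $A\Rightarrow B$ between summability methods means that every series summable $A$ is summable $B$. A condition ''$=O(1)$'' means the quantity is finite and bounded by a constant uniformly in the indicated free index. *)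

(* Defs.v *)
From mathcomp Require Export all_boot all_order all_algebra.
From mathcomp Require Export classical_sets reals ereal topology normedtype.
From mathcomp Require Export sequences exp.

Set Implicit Arguments.
Unset Strict Implicit.
Unset Printing Implicit Defensive.

Import Order.TTheory GRing.Theory Num.Theory.

Local Open Scope ring_scope.

(* [series u n] sums the terms of index < n; partial sums here are inclusive. *)
Definition psum (R : realType) (u : nat -> R) (n : nat) : R := series u n.+1.

Definition wmean (R : realType) (p a : nat -> R) (n : nat) : R :=
  (psum p n)^-1 * \sum_(0 <= i < n.+1) p i * psum a i.

(* [a] lists the terms of the series, not its partial sums. *)
Definition abs_Nbar_summable (R : realType) (p : nat -> R) (k : R)
    (a : nat -> R) : Prop :=
  (\sum_(1 <= n <oo)
     (n%:R `^ (k - 1) * `|wmean p a n - wmean p a n.-1| `^ k)%:E < +oo)%E.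

Definition abs_Nbar_implies (R : realType) (p q : nat -> R) (k : R) : Prop :=
  forall a : nat -> R, abs_Nbar_summable p k a -> abs_Nbar_summable q k a.

(* u_n = O(1) (n >= 1); the bound is real, so it also forces every u_n to be
   finite. *)
Definition bounded_from1 (R : realType) (u : nat -> \bar R) : Prop :=
  exists M : R, forall n : nat, (1 <= n)%N -> (`|u n| <= M%:E)%E.

(* The tail sum may be +oo. The product is that of the extended reals, where
   +oo * 0 = 0; the second factor vanishes for every m exactly when q is
   proportional to p, and then the product is 0 even if the tail diverges. *)
Definition tail_head_product (R : realType) (p q : nat -> R) (k kstar : R)
    (m : nat) : \bar R :=
  ((\sum_(m.+1 <= n <oo)
      ((n%:R `^ (1 - k^-1) * (q n / (psum q n * psum q n.-1))) `^ k)%:E)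
     `^ k^-1
   * ((\sum_(1 <= v < m.+1)
         `|psum q v - q v * psum p v / p v| `^ kstar * v%:R^-1)
        `^ kstar^-1)%R%:E)%E.

(* Main.v *)
Require Import Defs.
From mathcomp Require Import all_classical esum hoelder.
From mathcomp Require Import ring lra.
Set Implicit Arguments.
Unset Strict Implicit.
Unset Printing Implicit Defensive.
Import Order.TTheory GRing.Theory Num.Theory.
Local Open Scope ring_scope.

(** Write T and U for the weighted means of one series with respect to p and
    q, and X, Y for their successive differences.  Summation by parts gives
      U_n = T_n - (1 / Q_n) * sum_(v <= n) c_v X_v,
      c_v = Q_v - q_v P_v / p_v,
    hence, with l the conjugate index of k and x_n = n^(1/l) X_n,
    y_n = n^(1/l) Y_n,
      y_n = d_n x_n + a_n * sum_(v < n) b_v x_v,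
    where d_n = q_n P_n / (p_n Q_n), a_n = n^(1 - 1/k) q_n / (Q_n Q_(n-1)) and
    b_v = c_v v^(-1/l).  Absolute summability of index k says that x, resp. y,
    lies in l^k, and every x arises from some series, so the question is when
    the sum of a diagonal and a strictly lower triangular factorable matrix
    maps l^k into itself.  The answer [diag_plus_factorable_lkP] is: exactly
    when d is bounded and
      (sum_(n >= m) a_n^k)^(1/k) * (sum_(v < m) |b_v|^l)^(1/l)
    is bounded in m, which are the two conditions to be proved.

    Sufficiency is a discrete weighted Hardy inequality ([hardy_le]).  Let U_m
    and V_m be the two factors of the product above, so that U_m V_m <= M.
    Hoelder's inequality with the weights V_(v+1) - V_v bounds the inner sums;
    the tangent inequality for powers turns a_n^k = U_n^k - U_(n+1)^k into a
    multiple of U_n^(k-1) (U_n - U_(n+1)), and an Abel summation finishes.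

    Necessity rests on a uniform boundedness principle for monotone positively
    homogeneous functionals of nonnegative sequences
    ([monotone_homogeneous_bounded]).  To reach nonnegative functionals from
    the signed matrix, the signs of x are chosen freely: first so that the
    diagonal and the triangular contributions to y_n never cancel, which
    bounds d; then, the diagonal part being harmless, so that all the products
    b_v x_v are nonnegative, which leaves sum_n (a_n sum_(v < n) |b_v| |x_v|)^k.
    Testing its boundedness on the sequences |b_v|^l cut off at m gives the
    bound on the product. *)

(** * Powers with conjugate exponents *)

Lemma conjugate_gt0 (R : realType) (p q : R) :
  1 < p -> p^-1 + q^-1 = 1 -> 0 < q.
Proof.
move=> p1 pq; rewrite -invr_gt0.
have : p^-1 < 1 by rewrite invf_lt1 ?(lt_trans ltr01).
by lra.
Qed.

Lemma conjugate_gt1 (R : realType) (p q : R) :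
  1 < p -> p^-1 + q^-1 = 1 -> 1 < q.
Proof.
move=> p1 pq; have q0 := conjugate_gt0 p1 pq.
rewrite -invf_lt1//; have : 0 < p^-1 by rewrite invr_gt0 (lt_trans ltr01).
by lra.
Qed.

Lemma conjugate_div (R : realType) (p q : R) :
  1 < p -> p^-1 + q^-1 = 1 -> p * q^-1 = p - 1.
Proof.
move=> p1 pq; have -> : q^-1 = 1 - p^-1 by lra.
by field; rewrite gt_eqF// (lt_trans ltr01).
Qed.

Lemma conjugate_mulB1 (R : realType) (p q : R) :
  1 < p -> p^-1 + q^-1 = 1 -> (p - 1) * q = p.
Proof.
move=> p1 pq; rewrite -(conjugate_div p1 pq) mulfVK// gt_eqF//.
exact: conjugate_gt0 pq.
Qed.

(** The convexity of the k-th power, in tangent form; it is Young's inequality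
    for y and x^(k-1). *)
Lemma powR_subr_le (R : realType) (k x y : R) : 1 < k -> 0 <= x -> 0 <= y ->
  x `^ k - y `^ k <= k * x `^ (k - 1) * (x - y).
Proof.
move=> k1 x0 y0; have k0 : 0 < k by exact: lt_trans k1.
pose l := (1 - k^-1)^-1.
have kl : k^-1 + l^-1 = 1 by rewrite /l invrK addrC subrK.
have l0 := conjugate_gt0 k1 kl.
have := conjugate_powR y0 (powR_ge0 x (k - 1)) k0 l0 kl.
rewrite -powRrM (conjugate_mulB1 k1 kl) => young.
rewrite mulrBr -(mulrA k _ x) (mulrC _ x) mulr_powRB1//.
have {young} : k * (y * x `^ (k - 1)) <= y `^ k + (k - 1) * x `^ k.
  apply: le_trans (ler_wpM2l (ltW k0) young) _.
  rewrite mulrDr (mulrC (y `^ k)) mulVKf ?gt_eqF// (mulrC (x `^ k)) mulrA.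
  by rewrite (conjugate_div k1 kl).
by lra.
Qed.

(** Hoelder's inequality for sum_v D_v^(1/l) g_v^(1/k), raised to the power k.
    The hypothesis s <= D^(1/l) g^(1/k) is stated without roots or quotients,
    so that it remains meaningful where a weight D_v vanishes. *)
Lemma sum_powR_le (R : realType) (k l : R) (s D g : nat -> R) (n : nat) :
  1 < k -> k^-1 + l^-1 = 1 ->
  (forall v, 0 <= s v) -> (forall v, 0 <= D v) -> (forall v, 0 <= g v) ->
  (forall v, s v `^ k <= D v `^ (k - 1) * g v) ->
  (\sum_(0 <= v < n) s v) `^ k <=
    (\sum_(0 <= v < n) D v) `^ (k - 1) * \sum_(0 <= v < n) g v.
Proof.
move=> k1 kl s0 D0 g0 sDg; have k0 : 0 < k by exact: lt_trans k1.
have l0 := conjugate_gt0 k1 kl.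
have kV : 0 <= k^-1 by rewrite invr_ge0 ltW.
have root x y z : 0 <= x -> 0 <= y -> 0 <= z -> x `^ k <= y `^ (k - 1) * z ->
    x <= z `^ k^-1 * y `^ l^-1.
  move=> x0 y0 z0 xyz.
  rewrite -[x]powRr1// -(divff (lt0r_neq0 k0)) powRrM.
  have := ge0_ler_powR kV _ _ xyz; rewrite !nnegrE powR_ge0 mulr_ge0 ?powR_ge0//.
  have e : (k - 1) * k^-1 = l^-1.
    by rewrite -(conjugate_div k1 kl) mulrC mulKf// gt_eqF.
  by move=> /(_ isT isT); rewrite powRM ?powR_ge0// -(powRrM y) e mulrC.
have powerk x y : 0 <= x -> 0 <= y ->
    (x `^ k^-1 * y `^ l^-1) `^ k = y `^ (k - 1) * x.
  move=> x0 y0; rewrite powRM ?powR_ge0// -!powRrM mulVf ?gt_eqF// powRr1//.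
  by rewrite [l^-1 * k]mulrC (conjugate_div k1 kl) mulrC.
have S0 (f : nat -> R) N : (forall v, 0 <= f v) -> 0 <= \sum_(0 <= v < N) f v.
  by move=> f0; apply: sumr_ge0.
elim: n => [|n IH].
  by rewrite !big_geq// powR0 ?gt_eqF// mulr0.
rewrite !big_nat_recr//= -powerk ?addr_ge0 ?S0//.
apply: ge0_ler_powR; rewrite ?nnegrE ?(ltW k0) ?mulr_ge0 ?powR_ge0 ?addr_ge0 ?S0//.
have cancel x m : 0 < m -> 0 <= x -> (x `^ m^-1) `^ m = x.
  by move=> m0 x0; rewrite -powRrM mulVf ?gt_eqF// powRr1.
have := hoelder2 (powR_ge0 (\sum_(0 <= v < n) g v) k^-1) (powR_ge0 (g n) k^-1)
  (powR_ge0 (\sum_(0 <= v < n) D v) l^-1) (powR_ge0 (D n) l^-1) k0 l0 kl.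
rewrite !cancel ?S0//; apply: le_trans.
by apply: lerD; apply: root; rewrite ?S0.
Qed.

(** * A discrete weighted Hardy inequality *)

Lemma sum_by_parts (R : realType) (U g : nat -> R) (N : nat) :
  \sum_(0 <= n < N) (U n - U n.+1) * \sum_(0 <= v < n) g v =
    \sum_(0 <= v < N) g v * U v.+1 - U N * \sum_(0 <= v < N) g v.
Proof.
elim: N => [|N IH]; first by rewrite !big_geq// mulr0 subrr.
by rewrite !big_nat_recr//= IH; ring.
Qed.

(** With D_v = V_(v+1) - V_v, the tangent inequality for the exponent l gives
    b_v^k <= l^(k-1) V_(v+1) D_v^(k-1), so Hoelder's inequality with weights
    D_v bounds the n-th inner sum to the power k by V_n^(k-1) G_n, where G_n
    sums l^(k-1) V_(v+1) r_v^k over v < n.  The tangent inequality for the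
    exponent k bounds a_n^k by k U_n^(k-1) (U_n - U_(n+1)).  As U_n V_n <= M,
    what remains is the sum of (U_n - U_(n+1)) G_n, which by parts is at most
    the sum of U_(v+1) V_(v+1) r_v^k, up to the factor l^(k-1). *)
Lemma hardy_le (R : realType) (k l M : R) (a b r U V : nat -> R) (N : nat) :
  1 < k -> k^-1 + l^-1 = 1 ->
  (forall n, 0 <= a n) -> (forall v, 0 <= b v) -> (forall v, 0 <= r v) ->
  (forall n, 0 <= U n) -> V 0 = 0 ->
  (forall n, U n.+1 <= U n) -> (forall n, V n <= V n.+1) ->
  (forall n, a n `^ k = U n `^ k - U n.+1 `^ k) ->
  (forall v, b v `^ l = V v.+1 `^ l - V v `^ l) ->
  (forall m, U m * V m <= M) ->
  \sum_(0 <= n < N) (a n * \sum_(0 <= v < n) b v * r v) `^ k <=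
    k * l `^ (k - 1) * M `^ k * \sum_(0 <= v < N) r v `^ k.
Proof.
move=> k1 kl a0 b0 r0 U0 V00 Udec Vinc aU bV UVM.
have k0 : 0 < k by exact: lt_trans k1.
have l1 := conjugate_gt1 k1 kl; have l0 : 0 < l by exact: lt_trans l1.
have k10 : 0 <= k - 1 by rewrite subr_ge0 ltW.
have V0 n : 0 <= V n by elim: n => [|n /le_trans]; [rewrite V00|apply].
have M0 : 0 <= M by exact: le_trans (mulr_ge0 (U0 0%N) (V0 0%N)) (UVM 0%N).
have lk : l^-1 + k^-1 = 1 by rewrite addrC.
pose c := l `^ (k - 1); have c0 : 0 <= c by exact: powR_ge0.
pose g v := c * V v.+1 * r v `^ k.
have g0 v : 0 <= g v by rewrite !mulr_ge0 ?powR_ge0.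
have D0 v : 0 <= V v.+1 - V v by rewrite subr_ge0.
have bVD v : b v `^ k <= c * (V v.+1 * (V v.+1 - V v) `^ (k - 1)).
  have -> : k = l * (k - 1) by rewrite mulrC (conjugate_mulB1 k1 kl).
  rewrite powRrM -/c.
  have -> : l * (k - 1) = k by rewrite mulrC (conjugate_mulB1 k1 kl).
  have : b v `^ l <= l * V v.+1 `^ (l - 1) * (V v.+1 - V v).
    by rewrite bV powR_subr_le.
  move=> /(ge0_ler_powR k10); rewrite !nnegrE.
  rewrite !(mulr_ge0, powR_ge0) ?(ltW l0)// => /(_ isT isT) /le_trans; apply.
  rewrite !powRM ?(mulr_ge0, powR_ge0) ?(ltW l0)// -powRrM.
  (* the conjugate relation in the form 1 / (k - 1) = l - 1 *)
  have -> : (l - 1) * (k - 1) = 1.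
    by have := conjugate_mulB1 k1 kl; have := conjugate_mulB1 l1 lk; lra.
  by rewrite powRr1// mulrA.
have inner n : (\sum_(0 <= v < n) b v * r v) `^ k <=
    V n `^ (k - 1) * \sum_(0 <= v < n) g v.
  have -> : V n = \sum_(0 <= v < n) (V v.+1 - V v).
    by rewrite telescope_sumr// V00 subr0.
  apply: (@sum_powR_le _ k l (fun v => b v * r v) (fun v => V v.+1 - V v) g n)
    => // v; first by rewrite mulr_ge0.
  rewrite powRM// /g mulrA ler_wpM2r ?powR_ge0//.
  by rewrite mulrC -mulrA.
have outer n : (a n * \sum_(0 <= v < n) b v * r v) `^ k <=
    k * M `^ (k - 1) * ((U n - U n.+1) * \sum_(0 <= v < n) g v).
  have G0 : 0 <= \sum_(0 <= v < n) g v by apply: sumr_ge0.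
  have S0 : 0 <= \sum_(0 <= v < n) b v * r v.
    by apply: sumr_ge0 => v _; rewrite mulr_ge0.
  rewrite powRM// aU.
  apply: le_trans (ler_pM _ (powR_ge0 _ _)
     (powR_subr_le k1 (U0 n) (U0 n.+1)) (inner n)) _.
    by rewrite -aU powR_ge0.
  rewrite [leLHS](_ : _ = k * (U n `^ (k - 1) * V n `^ (k - 1)) *
    ((U n - U n.+1) * \sum_(0 <= v < n) g v)); last by ring.
  rewrite ler_wpM2r ?mulr_ge0 ?subr_ge0// ler_wpM2l ?(ltW k0)//.
  by rewrite -powRM// ge0_ler_powR// nnegrE// mulr_ge0.
apply: le_trans (ler_sum_nat (fun n _ => outer n)) _.
rewrite -mulr_sumr sum_by_parts.
have G0 : 0 <= \sum_(0 <= v < N) g v by apply: sumr_ge0.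
have gU : \sum_(0 <= v < N) g v * U v.+1 <=
    c * M * \sum_(0 <= v < N) r v `^ k.
  rewrite mulr_sumr; apply: ler_sum => v _.
  rewrite /g mulrAC ler_wpM2r ?powR_ge0// -mulrA ler_wpM2l// mulrC.
  exact: UVM.
apply: (@le_trans _ _ (k * M `^ (k - 1) * (c * M * \sum_(0 <= v < N) r v `^ k))).
  rewrite ler_wpM2l ?mulr_ge0 ?powR_ge0 ?(ltW k0)//.
  by apply: le_trans gU; rewrite gerBl mulr_ge0.
by rewrite -(mulr_powRB1 M0 k0) le_eqVlt; apply/orP; left; apply/eqP; rewrite /c; ring.
Qed.

(** * Series of nonnegative terms *)

Lemma nneseries_le (R : realType) (f : nat -> R) (C : R) (m : nat) :
  (forall n, 0 <= f n) -> (forall N, \sum_(m <= n < N) f n <= C) ->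
  (\sum_(m <= n <oo) (f n)%:E <= C%:E)%E.
Proof.
move=> f0 fC; apply: lime_le.
  by apply: is_cvg_nneseries => n _ _; rewrite lee_fin.
by apply: nearW => N; rewrite sumEFin lee_fin.
Qed.

Lemma le_nneseries (R : realType) (f : nat -> R) (m N : nat) :
  (forall n, 0 <= f n) ->
  ((\sum_(m <= n < N) f n)%:E <= \sum_(m <= n <oo) (f n)%:E)%E.
Proof.
by move=> f0; rewrite -sumEFin; apply: nneseries_lim_ge => n _ _; rewrite lee_fin.
Qed.

Lemma le_nneseries_tail (R : realType) (f g : nat -> R) (m : nat) :
  (forall n, 0 <= f n) -> (forall n, 0 <= g n) ->
  (forall n, (m <= n)%N -> f n <= g n) ->
  (\sum_(m <= n <oo) (f n)%:E <= \sum_(m <= n <oo) (g n)%:E)%E.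
Proof.
move=> f0 g0 fg; rewrite -(@nneseries_addn _ (fun n => (f n)%:E)) => [|n]; last first.
  by rewrite lee_fin.
rewrite -(@nneseries_addn _ (fun n => (g n)%:E)) => [|n]; last by rewrite lee_fin.
by apply: lee_nneseries => n *; rewrite lee_fin// fg// leq_addl.
Qed.

Lemma le_nneseries1 (R : realType) (f : nat -> \bar R) (n : nat) :
  (forall i, 0 <= f i)%E -> (f n <= \sum_(0 <= i <oo) f i)%E.
Proof.
move=> f0; rewrite (@nneseriesD1 _ f n predT)// leeDl// nneseries_ge0// => i _ _; exact: f0.
Qed.

(** * A uniform boundedness principle *)

Lemma sum_half_powers_le1 (R : realType) :
  (\sum_(0 <= j <oo) ((2^-1 : R) ^+ j.+1)%:E <= 1)%E.
Proof.
apply: nneseries_le => [n|N]; first by rewrite exprn_ge0// invr_ge0.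
have -> : \sum_(0 <= j < N) (2^-1 : R) ^+ j.+1 = 1 - 2^-1 ^+ N.
  elim: N => [|N IH]; first by rewrite big_geq// expr0 subrr.
  by rewrite big_nat_recr//= IH exprS; field.
by rewrite gerBl exprn_ge0// invr_ge0.
Qed.

(** A uniform boundedness principle.  If the functional were unbounded on the
    summable sequences of sum at most 1, take u_j there with value above
    4^(j+1); the superposition w = sum_j 2^-(j+1) u_j is still summable, and by
    monotonicity and homogeneity its value exceeds 2^(j+1) for every j. *)
Lemma monotone_homogeneous_bounded (R : realType)
    (Phi : (nat -> R) -> \bar R) :
  (forall u v, (forall n, 0 <= u n) -> (forall n, u n <= v n) ->
    (Phi u <= Phi v)%E) ->
  (forall c u, 0 < c -> (forall n, 0 <= u n) ->
    Phi (fun n => c * u n) = (c%:E * Phi u)%E) ->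
  (forall u, (forall n, 0 <= u n) -> (\sum_(0 <= n <oo) (u n)%:E < +oo)%E ->
    (Phi u < +oo)%E) ->
  exists C : R, forall u, (forall n, 0 <= u n) ->
    (\sum_(0 <= n <oo) (u n)%:E <= 1)%E -> (Phi u <= C%:E)%E.
Proof.
move=> Phi_mono Phi_homo Phi_fin; apply: contrapT => /forallNP unbounded.
have /choice[u uP] : forall j, exists u : nat -> R, [/\ forall n, 0 <= u n,
    (\sum_(0 <= n <oo) (u n)%:E <= 1)%E & ((4 ^+ j.+1)%:E < Phi u)%E].
  move=> j; have /existsNP[u /not_implyP[u0 /not_implyP[u1 /negP]]] :=
    unbounded (4 ^+ j.+1).
  by rewrite -ltNge => uC; exists u.
have u0 j n : 0 <= u j n by case: (uP j).
pose h j : R := 2^-1 ^+ j.+1.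
have h0 j : 0 < h j by rewrite exprn_gt0// invr_gt0.
have hu0 j n : (0 <= (h j * u j n)%:E)%E by rewrite lee_fin mulr_ge0// ltW.
pose w n := (\sum_(0 <= j <oo) (h j * u j n)%:E)%E.
have w0 n : (0 <= w n)%E by apply: nneseries_ge0.
have sumw : (\sum_(0 <= n <oo) w n <= 1)%E.
  rewrite nneseries_interchange//.
  apply: le_trans (sum_half_powers_le1 R).
  apply: lee_nneseries => [j _ _|j _]; first exact: nneseries_ge0.
  under eq_eseriesr do rewrite EFinM.
  rewrite nneseriesZl => [|n _]; last by rewrite lee_fin.
  rewrite -[leRHS]mule1 lee_pmul2l ?lte_fin// ?h0//.
  by case: (uP j).
have wfin n : (w n \is a fin_num)%E.
  rewrite ge0_fin_numE// (le_lt_trans _ (ltry 1))//.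
  exact: le_trans (le_nneseries1 n w0) sumw.
have fw0 n : 0 <= fine (w n) by exact: fine_ge0.
have : (Phi (fun n => fine (w n)) < +oo)%E.
  apply: Phi_fin => //; under eq_eseriesr do rewrite fineK//.
  by rewrite (le_lt_trans sumw)// ltry.
have below j : ((2 ^+ j.+1)%:E <= Phi (fun n => fine (w n)))%E.
  have : (Phi (fun n => (h j * u j n)%R) <= Phi (fun n => fine (w n)))%E.
    apply: Phi_mono => n; first by rewrite mulr_ge0// ltW.
    by rewrite -lee_fin fineK//; exact: (le_nneseries1 j (hu0 ^~ n)).
  rewrite Phi_homo//; apply: le_trans.
  have [_ _ /ltW big] := uP j.
  apply: le_trans (lee_wpmul2l _ big); last by rewrite lee_fin ltW.
  by rewrite -EFinM lee_fin -exprMn (_ : 2^-1 * 4 = 2)//; field.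
have Phi0 : (0 <= Phi (fun n => fine (w n)))%E.
  by apply: le_trans (below 0%N); rewrite lee_fin exprn_ge0.
rewrite -ge0_fin_numE// => Phifin.
pose N := (Num.truncn (fine (Phi (fun n => fine (w n))))).+1.
have := below N; rewrite -(fineK Phifin) lee_fin leNgt => /negP; apply.
apply: (@lt_le_trans _ _ N%:R); first exact: truncnS_gt.
by rewrite -natrX ler_nat (leq_trans (ltnW (ltn_expl N (isT : (1 < 2)%N))))// leq_exp2l.
Qed.

(** * Diagonal plus factorable matrices on the space of k-summable sequences *)

Definition lk_sum (R : realType) (k : R) (x : nat -> R) : \bar R :=
  (\sum_(0 <= n <oo) (`|x n| `^ k)%:E)%E.

Definition diag_plus_factorable (R : realType) (d a b x : nat -> R) (n : nat) : R :=
  d n * x n + a n * \sum_(0 <= v < n) b v * x v.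

Lemma lk_sum_lty_le (R : realType) (k C : R) (x y : nat -> R) :
  0 < k -> 0 <= C -> (forall n, `|y n| <= C * `|x n|) ->
  (lk_sum k x < +oo)%E -> (lk_sum k y < +oo)%E.
Proof.
move=> k0 C0 yx xk.
apply: (@le_lt_trans _ _ ((C `^ k)%:E * lk_sum k x)%E); last first.
  by rewrite lte_mul_pinfty// ?lee_fin ?powR_ge0.
rewrite -nneseriesZl => [|n _]; last by rewrite lee_fin powR_ge0.
apply: lee_nneseries => [n _ _|n _]; first by rewrite lee_fin powR_ge0.
rewrite -EFinM lee_fin -powRM//.
by rewrite ge0_ler_powR ?(ltW k0)// nnegrE// mulr_ge0.
Qed.

Lemma lk_sum_ltyD (R : realType) (k : R) (x y z : nat -> R) : 0 < k ->
  (forall n, `|z n| <= `|x n| + `|y n|) ->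
  (lk_sum k x < +oo)%E -> (lk_sum k y < +oo)%E -> (lk_sum k z < +oo)%E.
Proof.
move=> k0 zxy xk yk.
have : (lk_sum k (fun n => Num.max `|x n|%R `|y n|%R) < +oo)%E.
  apply: (@le_lt_trans _ _ (lk_sum k x + lk_sum k y)%E); last exact: lte_add_pinfty.
  rewrite -nneseriesD => [|n _ _|n _ _]; rewrite ?lee_fin ?powR_ge0//.
  apply: lee_nneseries => [n _ _|n _]; first by rewrite lee_fin powR_ge0.
  rewrite -EFinD lee_fin; case: (leP `|x n|%R `|y n|%R) => _; rewrite normr_id.
    by rewrite lerDr powR_ge0.
  by rewrite lerDl powR_ge0.
apply: (@lk_sum_lty_le _ _ 2) => // n.
rewrite [X in _ * X]ger0_norm ?le_max ?normr_ge0//; apply: le_trans (zxy n) _.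
by rewrite mulr_natl mulr2n lerD// le_max lexx ?orbT.
Qed.

Lemma nneseries_tail_lty (R : realType) (f : nat -> R) (m : nat) :
  (forall n, 0 <= f n) ->
  (\sum_(m <= n <oo) (f n)%:E < +oo)%E -> (\sum_(0 <= n <oo) (f n)%:E < +oo)%E.
Proof.
move=> f0 fm; rewrite (@nneseries_split _ _ 0 m)/= => [|n _]; last by rewrite lee_fin.
by rewrite add0n sumEFin lte_add_pinfty// ltry.
Qed.

Lemma sum_truncated_le (R : realType) (f : nat -> R) (m N : nat) :
  (forall v, 0 <= f v) ->
  \sum_(0 <= v < N) (if (v < m)%N then f v else 0) <= \sum_(0 <= v < m) f v.
Proof.
move=> f0; rewrite -big_mkcond/= [leLHS](@big_nat_widen _ _ _ _ _ (maxn m N)) ?leq_maxr//.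
rewrite [leRHS](@big_nat_widen _ _ _ _ _ (maxn m N)) ?leq_maxl//.
rewrite big_mkcond [leRHS]big_mkcond/=; apply: ler_sum => v _.
by case: (v < m)%N; case: (v < N)%N.
Qed.

Section factorable.
Context {R : realType} (k l : R).
Hypotheses (k1 : 1 < k) (kl : k^-1 + l^-1 = 1).
Context (d a b : nat -> R).
Hypotheses (d0 : forall n, 0 <= d n) (a0 : forall n, 0 <= a n).
Let L := diag_plus_factorable d a b.
Let k0 : 0 < k. Proof. exact: lt_trans k1. Qed.
Let l0 : 0 < l. Proof. exact: conjugate_gt0 k1 kl. Qed.
Let l1 : 1 < l. Proof. exact: conjugate_gt1 k1 kl. Qed.
Let lk : l^-1 + k^-1 = 1. Proof. by rewrite addrC. Qed.
Let kN0 : k != 0. Proof. by rewrite gt_eqF. Qed.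
Let lN0 : l != 0. Proof. by rewrite gt_eqF. Qed.
Let kVN0 : k^-1 != 0. Proof. by rewrite invr_eq0. Qed.
Let lVN0 : l^-1 != 0. Proof. by rewrite invr_eq0. Qed.
Let powVK (x p : R) : p != 0 -> 0 <= x -> (x `^ p^-1) `^ p = x.
Proof. by move=> p0 x0; rewrite -powRrM mulVf// powRr1. Qed.
Let powKV (x p : R) : p != 0 -> 0 <= x -> (x `^ p) `^ p^-1 = x.
Proof. by move=> p0 x0; rewrite -powRrM divff// powRr1. Qed.

(** The tail may be infinite, in which case the product is finite only when the
    head vanishes. *)
Definition tail_head (m : nat) : \bar R :=
  ((\sum_(m <= n <oo) (a n `^ k)%:E) `^ k^-1
   * ((\sum_(0 <= v < m) `|b v| `^ l) `^ l^-1)%:E)%E.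

Let head0 m : 0 <= \sum_(0 <= v < m) `|b v| `^ l.
Proof. by apply: sumr_ge0 => v _; exact: powR_ge0. Qed.

(** If the sequence a is not in l^k, every tail is infinite, so every head must
    vanish and the matrix is zero.  Otherwise the roots of tails and heads are
    real sequences to which [hardy_le] applies, on each initial segment. *)
Lemma factorable_lk (M : R) (x : nat -> R) :
  (forall m, (tail_head m <= M%:E)%E) -> (lk_sum k x < +oo)%E ->
  (lk_sum k (fun n => (a n * \sum_(0 <= v < n) b v * x v)%R) < +oo)%E.
Proof.
move=> thM xk.
have ak0 n : 0 <= a n `^ k by exact: powR_ge0.
have bl0 v : 0 <= `|b v| `^ l by exact: powR_ge0.
have tail0 m : (0 <= \sum_(m <= n <oo) (a n `^ k)%:E)%E.
  by apply: nneseries_ge0 => n _ _; rewrite lee_fin.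
have [afin|] := boolP (\sum_(0 <= n <oo) (a n `^ k)%:E < +oo)%E; last first.
  move=> ainf; have b_eq0 v : b v = 0.
    have tail_oo : (\sum_(v.+1 <= n <oo) (a n `^ k)%:E = +oo)%E.
      apply/eqP; rewrite eq_le leey /= leNgt; apply: contra ainf.
      exact: nneseries_tail_lty.
    have := thM v.+1; rewrite /tail_head tail_oo poweRyr//.
    have [h0|hN0] := eqVneq (\sum_(0 <= i < v.+1) `|b i| `^ l) 0; last first.
      by rewrite gt0_mulye ?leye_eq// lte_fin powR_gt0// lt0r hN0 head0.
    move=> _; apply/normr0_eq0/(@powR_eq0_eq0 _ _ l)/eqP.
    rewrite eq_le bl0 andbT -h0 big_nat_recr//= lerDr.
    exact: head0.
  rewrite /lk_sum eseries0// => n _ _ /=; rewrite big1 => [|v _].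
    by rewrite mulr0 normr0 powR0.
  by rewrite b_eq0 mul0r.
have tfin m : (\sum_(m <= n <oo) (a n `^ k)%:E)%E \is a fin_num.
  rewrite ge0_fin_numE// (le_lt_trans _ afin)//.
  rewrite [leRHS](@nneseries_split _ _ 0 m)/= => [|n _]; last by rewrite lee_fin.
  by rewrite add0n leeDr// sume_ge0// => n _; rewrite lee_fin.
pose A m := fine (\sum_(m <= n <oo) (a n `^ k)%:E)%E.
have A0 m : 0 <= A m by exact: fine_ge0.
have AS n : A n = a n `^ k + A n.+1.
  apply: EFin_inj; rewrite EFinD /A !fineK//.
  rewrite (@nneseries_split _ _ n 1)/= => [|i _]; last by rewrite lee_fin.
  by rewrite addn1 big_nat1.
pose U m := A m `^ k^-1.
pose B m := \sum_(0 <= v < m) `|b v| `^ l.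
pose V m := B m `^ l^-1.
have kV : 0 <= k^-1 by rewrite invr_ge0 ltW.
have lV : 0 <= l^-1 by rewrite invr_ge0 ltW.
have UVM m : U m * V m <= M.
  rewrite -lee_fin EFinM -(poweR_EFin (A m)) fineK//; exact: thM.
have r0 v : 0 <= `|x v| `^ k by exact: powR_ge0.
have xfin : lk_sum k x \is a fin_num.
  by rewrite ge0_fin_numE// nneseries_ge0// => n _ _; rewrite lee_fin.
pose C := k * l `^ (k - 1) * M `^ k.
have C0 : 0 <= C by rewrite !mulr_ge0 ?powR_ge0// ltW.
apply: (@le_lt_trans _ _ (C * fine (lk_sum k x))%:E); last exact: ltry.
apply: nneseries_le => [n|N]; first exact: powR_ge0.
apply: (@le_trans _ _ (C * \sum_(0 <= v < N) `|x v| `^ k)); last first.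
  by rewrite ler_wpM2l// -lee_fin fineK//; exact: le_nneseries.
apply: (@le_trans _ _ (\sum_(0 <= n < N)
    (a n * \sum_(0 <= v < n) `|b v| * `|x v|) `^ k)).
  apply: ler_sum => n _; apply: ge0_ler_powR; rewrite ?nnegrE ?(ltW k0)//.
    by rewrite mulr_ge0// sumr_ge0// => v _; rewrite mulr_ge0.
  rewrite normrM (ger0_norm (a0 n)) ler_wpM2l//.
  by apply: le_trans (ler_norm_sum _ _ _) _; apply: ler_sum => v _; rewrite normrM.
apply: (@hardy_le _ k l M a (fun v => `|b v|) (fun v => `|x v|) U V N) => //.
- by move=> n; exact: powR_ge0.
- by rewrite /V /B big_geq// powR0.
- move=> n; apply: ge0_ler_powR; rewrite ?nnegrE//.
  by rewrite [leRHS]AS lerDr.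
- move=> n; apply: ge0_ler_powR; rewrite ?nnegrE ?head0//.
  by rewrite /B big_nat_recr//= lerDl.
- by move=> n; rewrite /U !powVK// [in RHS]AS addrK.
- by move=> v; rewrite /V !powVK ?head0// /B big_nat_recr//= addrAC subrr add0r.
Qed.

Lemma diag_lk (M : R) (x : nat -> R) : (forall n, d n <= M) ->
  (lk_sum k x < +oo)%E -> (lk_sum k (fun n => (d n * x n)%R) < +oo)%E.
Proof.
move=> dM; apply: (@lk_sum_lty_le _ _ M) => // [|n].
  exact: le_trans (d0 0%N) (dM 0%N).
by rewrite normrM (ger0_norm (d0 n)) ler_wpM2r.
Qed.

Hypothesis Lk : forall x, (lk_sum k x < +oo)%E -> (lk_sum k (L x) < +oo)%E.

(** Given u summable, let x have modulus u^(1/k) and, recursively, the sign of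
    the triangular sum S_n = sum_(v < n) b_v x_v, which involves only earlier
    entries.  Then the n-th entry of the image is at least d_n |x_n| in modulus,
    so the functional sum_n d_n^k u_n is finite at u; its value
    at the n-th unit sequence is d_n^k, which is therefore bounded. *)
Lemma preserving_diag_bounded : exists M : R, forall n, d n <= M.
Proof.
pose Phi (u : nat -> R) : \bar R := (\sum_(0 <= n <oo) (d n `^ k * u n)%:E)%E.
have du0 u n : (forall n, 0 <= u n) -> 0 <= d n `^ k * u n.
  by move=> u0; rewrite mulr_ge0// powR_ge0.
have [u v u0 uv|c u c0 u0|u u0 ufin|C PhiC] := @monotone_homogeneous_bounded R Phi.
- apply: lee_nneseries => [n _ _|n _]; rewrite lee_fin ?du0//.
  by rewrite ler_wpM2l// powR_ge0.
- rewrite /Phi -nneseriesZl => [|n _]; last by rewrite lee_fin du0.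
  by apply: eq_eseriesr => n _; rewrite -EFinM mulrCA.
- pose sg (s : R) : R := (-1) ^+ (s < 0)%R.
  pose r n := u n `^ k^-1.
  pose S := fix S n := if n is m.+1 then S m + b m * (sg (S m) * r m) else 0.
  pose x n := sg (S n) * r n.
  have normx n : `|x n| `^ k = u n.
    by rewrite /x normrMsign ger0_norm ?powR_ge0// powVK.
  have Ssum n : \sum_(0 <= v < n) b v * x v = S n.
    by elim: n => [|n IH]; [rewrite big_geq|rewrite big_nat_recr//= IH].
  have : (lk_sum k x < +oo)%E.
    by rewrite /lk_sum; under eq_eseriesr do rewrite normx.
  move=> /Lk; apply: le_lt_trans.
  apply: lee_nneseries => [n _ _|n _]; rewrite lee_fin ?du0//.
  rewrite -(normx n) -powRM//.
  rewrite ge0_ler_powR ?nnegrE ?(ltW k0) ?mulr_ge0//.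
  rewrite /L /diag_plus_factorable Ssum [in leRHS](realEsign (num_real (S n))).
  rewrite /x mulrCA [a n * _]mulrCA -mulrDr !normrMsign.
  rewrite (ger0_norm (powR_ge0 _ _)) ger0_norm ?lerDl ?addr_ge0 ?mulr_ge0 ?powR_ge0//.
- exists (Num.max 1 C) => n.
  pose u i : R := (i == n)%:R.
  have u0 i : 0 <= u i by exact: ler0n.
  have [dn1|/ltW dn1] := leP (d n) 1; first by rewrite le_max dn1.
  rewrite le_max; apply/orP; right.
  have usum : (\sum_(0 <= i <oo) (u i)%:E <= 1)%E.
    apply: nneseries_le => // N.
    rewrite (eq_bigr (fun i => if i == n then 1 else 0)).
      rewrite -big_mkcond/= big_const_seq count_uniq_mem ?iota_uniq//=.
      by case: (_ \in _); rewrite /= ?addr0.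
    by move=> i _; rewrite /u; case: eqP.
  have := PhiC u u0 usum; rewrite -lee_fin; apply: le_trans.
  apply: (@le_trans _ _ (d n `^ k * u n)%:E).
    by rewrite lee_fin /u eqxx mulr1 le1r_powR// ltW.
  apply: (@le_nneseries1 _ (fun i => (d i `^ k * u i)%:E)) => i.
  by rewrite lee_fin du0.
Qed.

(** The diagonal part preserves l^k because d is bounded, hence so does the
    triangular part by subtraction.  Giving x_v the sign of b_v makes the
    functional sum_n (a_n sum_(v < n) |b_v| u_v^(1/k))^k finite at every
    summable u, hence bounded by some C.  With B = sum_(v < m) |b_v|^l, the
    equality case of Hoelder's inequality suggests to test it on
    u_v = |b_v|^l / B for v < m: the inner sums are B^(1/l) from n = m on, so
    the m-th tail times B^(k/l) is at most C. *)
Lemma preserving_tail_head_bounded :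
  exists M : R, forall m, (tail_head m <= M%:E)%E.
Proof.
have [D dD] := preserving_diag_bounded.
pose F (u : nat -> R) n := a n * \sum_(0 <= v < n) `|b v| * u v `^ k^-1.
have F0 u n : 0 <= F u n.
  by rewrite mulr_ge0// sumr_ge0// => v _; rewrite mulr_ge0// powR_ge0.
pose Phi (u : nat -> R) : \bar R := (\sum_(0 <= n <oo) (F u n `^ k)%:E)%E.
have kV : 0 <= k^-1 by rewrite invr_ge0 ltW.
have Fmono u v n : (forall n, 0 <= u n) -> (forall n, u n <= v n) ->
    F u n <= F v n.
  move=> u0 uv; rewrite ler_wpM2l// ler_sum// => i _.
  by rewrite ler_wpM2l// ge0_ler_powR// nnegrE// (le_trans (u0 i)).
have [u v u0 uv|c u c0 u0|u u0 ufin|C PhiC] := @monotone_homogeneous_bounded R Phi.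
- apply: (@le_nneseries_tail _ (fun n => F u n `^ k) (fun n => F v n `^ k) 0).
  + by move=> n; exact: powR_ge0.
  + by move=> n; exact: powR_ge0.
  + move=> n _; apply: ge0_ler_powR; rewrite ?nnegrE ?(ltW k0) ?F0//.
    exact: Fmono.
- rewrite /Phi -nneseriesZl => [|n _]; last by rewrite lee_fin powR_ge0.
  apply: eq_eseriesr => n _; rewrite -EFinM -[in RHS](powVK kN0 (ltW c0)).
  rewrite -powRM ?powR_ge0//; congr ((_ `^ _)%:E).
  rewrite /F mulrCA; congr (_ * _); rewrite mulr_sumr; apply: eq_bigr => v _.
  by rewrite powRM ?(ltW c0)// mulrCA.
- pose x v := (-1) ^+ (b v < 0)%R * u v `^ k^-1.
  have normx n : `|x n| `^ k = u n.
    by rewrite /x normrMsign ger0_norm ?powR_ge0// powVK.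
  have xfin : (lk_sum k x < +oo)%E.
    by rewrite /lk_sum; under eq_eseriesr do rewrite normx.
  have FE n : F u n = L x n - d n * x n.
    rewrite /L /diag_plus_factorable addrAC subrr add0r /F; congr (_ * _).
    apply: eq_bigr => v _; by rewrite /x normrEsign ?num_real// mulrCA mulrA.
  suff : (lk_sum k (F u) < +oo)%E.
    by rewrite /lk_sum; under eq_eseriesr do rewrite ger0_norm//.
  apply: (lk_sum_ltyD _ _ (Lk xfin) (diag_lk dD xfin)) => // n.
  by rewrite FE ler_normB.
- have C0 : 0 <= C.
    rewrite -lee_fin; apply: le_trans (PhiC (fun=> 0) _ _) => //.
      by apply: nneseries_ge0 => n _ _; rewrite lee_fin powR_ge0.
    by rewrite eseries0// lee01.
  exists (C `^ k^-1) => m; rewrite /tail_head.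
  set B := \sum_(0 <= v < m) `|b v| `^ l.
  have [B_eq0|BN0] := eqVneq B 0.
    by rewrite B_eq0 powR0// mule0 lee_fin powR_ge0.
  have B_gt0 : 0 < B by rewrite lt0r BN0 head0.
  pose u v := if (v < m)%N then `|b v| `^ l / B else 0.
  have u0 v : 0 <= u v.
    by rewrite /u; case: ifP => // _; rewrite divr_ge0 ?powR_ge0 ?ltW.
  have sumu N : \sum_(0 <= v < N) u v <= 1.
    apply: (@le_trans _ _ (\sum_(0 <= v < m) `|b v| `^ l / B)).
      by apply: sum_truncated_le => v; rewrite divr_ge0 ?powR_ge0// ltW.
    by rewrite -mulr_suml divff.
  have sum_test n : (m <= n)%N ->
      B `^ l^-1 <= \sum_(0 <= v < n) `|b v| * u v `^ k^-1.
    move=> mn; rewrite (@big_cat_nat _ _ _ m)//= -[leLHS]addr0 lerD//; last first.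
      by rewrite sumr_ge0// => v _; rewrite mulr_ge0// powR_ge0.
    have summand v : (v < m)%N ->
        `|b v| * u v `^ k^-1 = `|b v| `^ l * B^-1 `^ k^-1.
      move=> vm; rewrite /u vm powRM ?powR_ge0 ?invr_ge0 ?(ltW B_gt0)//.
      rewrite mulrA -powRrM (conjugate_div l1 lk) mulr_powRB1//.
    rewrite (eq_big_nat _ _ (F2 := fun v => `|b v| `^ l * B^-1 `^ k^-1)).
      rewrite -mulr_suml -/B -[X in X `^ k^-1]powR_inv1 ?(ltW B_gt0)//.
      rewrite -powRrM mulN1r -{2}[B]powRr1 ?(ltW B_gt0)//.
      by rewrite -powRD ?BN0 ?implybT// le_eqVlt -kl addrAC subrr add0r eqxx.
    by move=> v /andP[_]; exact: summand.
  have tail_le : ((\sum_(m <= n <oo) (a n `^ k)%:E) *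
      ((B `^ l^-1) `^ k)%:E <= C%:E)%E.
    have := PhiC u u0 (nneseries_le u0 sumu); apply: le_trans.
    rewrite /Phi (@nneseries_split _ _ 0 m)/= => [|n _]; last first.
      by rewrite lee_fin powR_ge0.
    rewrite add0n -[leLHS]add0e leeD//.
      by rewrite sume_ge0// => n _; rewrite lee_fin powR_ge0.
    rewrite muleC -nneseriesZl => [|n _]; last by rewrite lee_fin powR_ge0.
    under eq_eseriesr do rewrite -EFinM -powRM ?powR_ge0//.
    apply: le_nneseries_tail => n; rewrite ?powR_ge0// => mn.
    apply: ge0_ler_powR; rewrite ?nnegrE ?(ltW k0) ?F0//.
      by rewrite mulr_ge0 ?powR_ge0.
    by rewrite /F mulrC ler_wpM2l// sum_test.
  have tail0 : (0 <= \sum_(m <= n <oo) (a n `^ k)%:E)%E.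
    by apply: nneseries_ge0 => n _ _; rewrite lee_fin powR_ge0.
  have := gt0_ler_poweR kV _ _ tail_le.
  rewrite !in_itv/= !leey !andbT lee_fin C0 mule_ge0 ?lee_fin ?powR_ge0//.
  move=> /(_ isT isT); rewrite poweRM ?lee_fin ?powR_ge0//.
  by rewrite !poweR_EFin powKV ?powR_ge0.
Qed.

End factorable.

(** For d = 0 this is the weighted Hardy inequality together with its converse. *)
Theorem diag_plus_factorable_lkP (R : realType) (k l : R) (d a b : nat -> R) :
  1 < k -> k^-1 + l^-1 = 1 -> (forall n, 0 <= d n) -> (forall n, 0 <= a n) ->
  (forall x, (lk_sum k x < +oo)%E ->
    (lk_sum k (diag_plus_factorable d a b x) < +oo)%E) <->
  (exists M : R, forall n, d n <= M) /\
  (exists M : R, forall m, (tail_head k l a b m <= M%:E)%E).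
Proof.
move=> k1 kl d0 a0; split=> [Lk|[[M dM] [N thN]] x xk].
  split; first exact: (preserving_diag_bounded k1 d0 a0 Lk).
  exact: (preserving_tail_head_bounded k1 kl d0 a0 Lk).
apply: (lk_sum_ltyD (lt_trans ltr01 k1) _ (diag_lk k1 d0 dM xk)
  (factorable_lk k1 kl a0 thN xk)) => n.
exact: ler_normD.
Qed.

(** * The matrix carrying one weighted mean to another *)

Lemma psumS (R : realType) (u : nat -> R) (n : nat) :
  psum u n.+1 = psum u n + u n.+1.
Proof. by rewrite /psum seriesSr. Qed.

Lemma psum0 (R : realType) (u : nat -> R) : psum u 0 = u 0.
Proof. by rewrite /psum seriesEnat/= big_nat1. Qed.

Lemma psum_gt0 (R : realType) (u : nat -> R) (n : nat) :
  (forall i, 0 < u i) -> 0 < psum u n.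
Proof.
by move=> u0; elim: n => [|n IH]; rewrite ?psum0// psumS addr_gt0.
Qed.

Section mean_transfer.
Context {R : realType} (p q : nat -> R).
Hypotheses (p0 : forall n, 0 < p n) (q0 : forall n, 0 < q n).
Let pN0 n : p n != 0. Proof. exact: lt0r_neq0. Qed.
Let PN0 n : psum p n != 0. Proof. exact/lt0r_neq0/psum_gt0. Qed.
Let QN0 n : psum q n != 0. Proof. exact/lt0r_neq0/psum_gt0. Qed.

Definition wmean_step (w a : nat -> R) (n : nat) : R :=
  wmean w a n - wmean w a n.-1.

(** The coefficient through which the two means differ; it vanishes for every v
    exactly when q is proportional to p. *)
Definition defect (v : nat) : R := psum q v - q v * psum p v / p v.

Lemma defect0 : defect 0 = 0.
Proof. by rewrite /defect !psum0 mulfK// subrr. Qed.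

Lemma psum_wmean (w a : nat -> R) (n : nat) : psum w n != 0 ->
  psum w n * wmean w a n = \sum_(0 <= i < n.+1) w i * psum a i.
Proof. by move=> wn; rewrite /wmean mulVKf. Qed.

(** The means T determine the partial sums; substituting this into the other
    mean U expresses U by T alone. *)
Lemma psum_of_wmean (a : nat -> R) (n : nat) :
  psum a n.+1 =
    (psum p n.+1 * wmean p a n.+1 - psum p n * wmean p a n) / p n.+1.
Proof.
rewrite !psum_wmean// [X in (X - _) / _]big_nat_recr//= addrAC subrr add0r.
by rewrite mulrC mulKf.
Qed.

(** By induction: passing from n to n + 1 adds q_(n+1) s_(n+1) to Q_n U_n, and
    s_(n+1) is expressed by T_n and T_(n+1). *)
Lemma wmean_transfer (a : nat -> R) (n : nat) :
  psum q n * wmean q a n = psum q n * wmean p a n -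
    \sum_(0 <= v < n.+1) defect v * wmean_step p a v.
Proof.
elim: n => [|n IH].
  rewrite big_nat1 defect0 mul0r subr0 /wmean !big_nat1.
  by rewrite (psum0 p) (psum0 q) !mulKf// lt0r_neq0.
rewrite psum_wmean// big_nat_recr//= -psum_wmean// IH [in RHS]big_nat_recr//=.
rewrite psum_of_wmean /defect /wmean_step/= !psumS; field.
by rewrite pN0.
Qed.

Lemma wmean_step_transfer (a : nat -> R) (n : nat) :
  wmean_step q a n.+1 =
    (q n.+1 * psum p n.+1) / (p n.+1 * psum q n.+1) * wmean_step p a n.+1 +
    q n.+1 / (psum q n.+1 * psum q n) *
      \sum_(0 <= v < n.+1) defect v * wmean_step p a v.
Proof.
have solve m : wmean q a m = wmean p a m -
    (\sum_(0 <= v < m.+1) defect v * wmean_step p a v) / psum q m.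
  by apply: (mulfI (QN0 m)); rewrite wmean_transfer mulrBr [X in _ = _ - X]mulrC mulfVK.
rewrite {1}/wmean_step/= !solve big_nat_recr//=.
set S := \sum_(0 <= v < n.+1) _.
have QN := QN0 n.+1; rewrite psumS in QN.
rewrite /defect /wmean_step/= !psumS; field.
by rewrite QN QN0 pN0.
Qed.

Lemma wmean_surj (T : nat -> R) : exists a, forall n, wmean p a n = T n.
Proof.
pose s n := if n is m.+1 then (psum p m.+1 * T m.+1 - psum p m * T m) / p m.+1
  else T 0.
pose a n := if n is m.+1 then s m.+1 - s m else s 0.
have as_ n : psum a n = s n.
  by elim: n => [|n IH]; rewrite ?psum0// psumS IH /= addrC subrK.
exists a => n; apply: (mulfI (PN0 n)); rewrite psum_wmean//.
elim: n => [|n IH]; first by rewrite big_nat1 as_ psum0.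
by rewrite big_nat_recr//= IH as_ /s [p _ * _]mulrC mulfVK// addrC subrK.
Qed.
End mean_transfer.

(** The weight n^(1/l) has k-th power n^(k-1); at n = 0, where there is no
    step, both factors are zero. *)
Definition weighted_step (R : realType) (l : R) (w a : nat -> R) (n : nat) : R :=
  n%:R `^ l^-1 * wmean_step w a n.

Lemma abs_Nbar_summableE (R : realType) (k l : R) (w a : nat -> R) :
  1 < k -> k^-1 + l^-1 = 1 ->
  abs_Nbar_summable w k a <-> (lk_sum k (weighted_step l w a) < +oo)%E.
Proof.
move=> k1 kl; have k0 : 0 < k by exact: lt_trans k1.
have -> : lk_sum k (weighted_step l w a) = (\sum_(1 <= n <oo)
    (n%:R `^ (k - 1) * `|wmean w a n - wmean w a n.-1| `^ k)%:E)%E.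
  rewrite /lk_sum (@nneseries_split _ _ 0 1)/= => [|n _]; last first.
    by rewrite lee_fin powR_ge0.
  rewrite big_nat1 /weighted_step /wmean_step/= subrr mulr0 normr0.
  rewrite powR0 ?gt_eqF// add0e; apply: eq_eseriesr => n _.
  rewrite normrM powRM// ger0_norm ?powR_ge0// -powRrM mulrC.
  by rewrite [l^-1 * k]mulrC (conjugate_div k1 kl) mulrC.
by [].
Qed.

Section mean_matrix.
Context {R : realType} (p q : nat -> R) (k l : R).
Hypotheses (p0 : forall n, 0 < p n) (q0 : forall n, 0 < q n).
Hypotheses (k1 : 1 < k) (kl : k^-1 + l^-1 = 1).
Let k0 : 0 < k. Proof. exact: lt_trans k1. Qed.
Let l0 : 0 < l. Proof. exact: conjugate_gt0 k1 kl. Qed.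
Let lVN0 : l^-1 != 0. Proof. by rewrite invr_eq0 gt_eqF. Qed.

Definition mean_diag (n : nat) : R := (q n * psum p n) / (p n * psum q n).
Definition mean_row (n : nat) : R :=
  n%:R `^ (1 - k^-1) * (q n / (psum q n * psum q n.-1)).
Definition mean_col (v : nat) : R := defect p q v * v%:R `^ (- l^-1).
Let L := diag_plus_factorable mean_diag mean_row mean_col.

Lemma mean_diag_ge0 n : 0 <= mean_diag n.
Proof. by rewrite ltW// divr_gt0// mulr_gt0// psum_gt0. Qed.

Lemma mean_row_ge0 n : 0 <= mean_row n.
Proof.
by rewrite mulr_ge0 ?powR_ge0// ltW// divr_gt0// mulr_gt0// psum_gt0.
Qed.

Lemma mean_col0 : mean_col 0 = 0.
Proof. by rewrite /mean_col defect0// mul0r. Qed.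

(** At n = 0 both sides vanish through the weight; at v = 0 the column entry
    vanishes because the defect does. *)
Lemma weighted_step_transfer (a : nat -> R) (n : nat) :
  weighted_step l q a n = L (weighted_step l p a) n.
Proof.
have e : 1 - k^-1 = l^-1 by rewrite -kl addrAC subrr add0r.
rewrite /L /diag_plus_factorable /mean_row e.
case: n => [|n]; first by rewrite /weighted_step powR0// !mul0r mulr0 addr0.
have -> : \sum_(0 <= v < n.+1) mean_col v * weighted_step l p a v =
    \sum_(0 <= v < n.+1) defect p q v * wmean_step p a v.
  apply: eq_bigr => -[|v] _; first by rewrite mean_col0 defect0// !mul0r.
  rewrite /mean_col /weighted_step mulrA -(mulrA (defect p q _)).
  rewrite -powRD ?pnatr_eq0 ?implybT//.
  by rewrite addNr powRr0 mulr1.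
rewrite /weighted_step (wmean_step_transfer p0)//= mulrDr; congr (_ + _).
  by rewrite mulrCA.
by rewrite mulrA.
Qed.

(** Every x agrees, except at the index 0, with the weighted steps of some
    series, and changing x_0 changes the image only at the index 0, since the
    column entry of index 0 is zero. *)
Lemma abs_Nbar_impliesE :
  abs_Nbar_implies p q k <->
  (forall x, (lk_sum k x < +oo)%E -> (lk_sum k (L x) < +oo)%E).
Proof.
split=> [pq x xk|Lk a]; last first.
  move=> /(abs_Nbar_summableE _ _ k1 kl)/Lk La.
  apply/(abs_Nbar_summableE _ _ k1 kl); move: La; rewrite /lk_sum.
  by under eq_eseriesr do rewrite -weighted_step_transfer.
pose X n := if n is m.+1 then n%:R `^ (- l^-1) * x n else 0.
have [a aT] := wmean_surj p0 (fun n => \sum_(0 <= v < n.+1) X v).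
have step n : weighted_step l p a n = if n is m.+1 then x n else 0.
  rewrite /weighted_step /wmean_step !aT; case: n => [|n].
    by rewrite subrr mulr0.
  rewrite big_nat_recr//= addrAC subrr add0r mulrA.
  by rewrite -powRD ?pnatr_eq0 ?implybT// subrr powRr0 mul1r.
have : abs_Nbar_summable q k a.
  apply/pq/(abs_Nbar_summableE _ _ k1 kl).
  apply: (lk_sum_lty_le k0 ler01 _ xk) => -[|n]; rewrite step mul1r//.
  by rewrite normr0.
move=> /(abs_Nbar_summableE _ _ k1 kl).
rewrite /lk_sum => Lfin; apply: (@nneseries_tail_lty _ _ 1).
  by move=> n; exact: powR_ge0.
apply: le_lt_trans Lfin.
rewrite [leRHS](@nneseries_split _ _ 0 1)/= => [|n _]; last first.
  by rewrite lee_fin powR_ge0.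
rewrite big_nat1 -[leLHS]add0e add0n leeD ?lee_fin ?powR_ge0//.
apply: le_nneseries_tail => [n|n|[//|n] _]; rewrite ?powR_ge0//.
rewrite weighted_step_transfer /L /diag_plus_factorable step.
suff -> : \sum_(0 <= v < n.+1) mean_col v * weighted_step l p a v =
  \sum_(0 <= v < n.+1) mean_col v * x v by [].
by apply: eq_bigr => -[|v] _; rewrite step// mean_col0 !mul0r.
Qed.

Lemma tail_head_productE (m : nat) :
  tail_head_product p q k l m = tail_head k l mean_row mean_col m.+1.
Proof.
rewrite /tail_head_product /tail_head; congr (_ * (_ `^ _)%:E)%E.
rewrite [RHS]big_ltn// mean_col0 normr0 powR0 ?gt_eqF// add0r.
apply: eq_big_nat => -[//|v] _; rewrite /mean_col normrM powRM//.
rewrite (ger0_norm (powR_ge0 _ _)) -powRrM mulNr mulVf ?gt_eqF//.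
by rewrite powR_inv1.
Qed.

Lemma tail_head0 : tail_head k l mean_row mean_col 0 = 0%E.
Proof. by rewrite /tail_head big_geq// powR0// mule0. Qed.

Lemma tail_head1 : tail_head k l mean_row mean_col 1 = 0%E.
Proof.
rewrite /tail_head big_nat1 mean_col0 normr0 (powR0 (lt0r_neq0 l0)).
by rewrite powR0// mule0.
Qed.

Lemma tail_head_ge0 m : (0 <= tail_head k l mean_row mean_col m)%E.
Proof. by rewrite mule_ge0 ?poweR_ge0// lee_fin powR_ge0. Qed.

End mean_matrix.

Theorem corollary3 (R : realType) (p q : nat -> R) (k kstar : R)
    (hp : forall n : nat, 0 < p n) (hq : forall n : nat, 0 < q n)
    (hk : 1 < k) (hkstar : k^-1 + kstar^-1 = 1) :
  abs_Nbar_implies p q k <->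
  (bounded_from1 (fun n => ((q n * psum p n) / (p n * psum q n))%:E) /\
   bounded_from1 (tail_head_product p q k kstar)).
Proof.
rewrite (abs_Nbar_impliesE hp hq hk hkstar) (diag_plus_factorable_lkP _ hk hkstar);
  [|exact: mean_diag_ge0|exact: mean_row_ge0].
split=> [[[M dM] [N thN]]|[[M dM] [N thN]]].
- split; [exists M|exists N] => n _.
    by rewrite abse_EFin lee_fin ger0_norm ?mean_diag_ge0//; exact: dM.
  by rewrite tail_head_productE// gee0_abs ?tail_head_ge0.
- split; [exists (Num.max M (mean_diag p q 0))|exists N].
    case=> [|n]; first by rewrite le_max lexx orbT.
    have := dM n.+1 isT; rewrite abse_EFin lee_fin => /(le_trans (ler_norm _)).
    by rewrite le_max => ->.
  have N0 : (0 <= N%:E)%E by exact: le_trans (abse_ge0 _) (thN 1%N isT).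
  case=> [|[|m]]; first by rewrite tail_head0.
    by rewrite tail_head1.
  rewrite -tail_head_productE//; apply: le_trans (thN m.+1 isT).
  exact: lee_abs.
Qed.
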